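(* Let $G$ be a metabelian SSP group of $G(n,c)$-type with $n\ge3$ and canonical basis $(a_1,\dots,a_n)$. Then: (1) $c=c(n,j)$ for some integer $0\le j\le q(n)$; (2) if $G$ is non-abelian (i.e. $c<n$), then $[a_1,a_{c+1}]$ is a nontrivial element of $\langle a_{q(n)+1-j},\dots,a_{q(n)+1+r(n)+2j}\rangle$; (3) if $G$ is non-abelian, there is a bound $N$ (depending on $G$) such that every sequence $G=L_0,L_1,\dots,L_m$ in which each $L_{i+1}$ is a lifting of $L_i$ has $m\le N$.
   Context: Notation: $x^f$ is the image of $x$ under $f$; $[x,y]=x^{-1}y^{-1}xy$; $e$ is the identity. A triple $(G,H,f)$, where $H\le G$ and $f:H\to G$ is a homomorphism, is simple if the only subgroup $K\le H$ that is normal in $G$ and satisfies $K^f\le K$ is trivial. For such a triple put $G_0=G$, $H_0=H$, and for $k\ge1$, $G_k=(H_{k-1})^f$, $H_k=H\cap G_k$. Let $p$ be a prime or $\infty$. A polycyclic group $G$ is an SSP group with respect to $(G,H,f)$ if: (1) $f$ is injective; (2) each $(G_k,H_k,f|_{H_k})$ is a simple triple; (3) $H_k$ and $G_{k+1}$ are normal in $G_k$ and $G_k=H_kG_{k+1}$; (4) whenever $G_k$ is nontrivial, $G_k/H_k$ is cyclic of order $p$ (infinite cyclic if $p=\infty$). The length $n$ is the Hirsch length if $p=\infty$ and $\log_p|G|$ if $p$ is prime. A canonical basis of $G$ is a tuple $(a_1,\dots,a_n)$ with $a_1,\dots,a_{n-1}\in H$, $a_{i+1}=a_i^f$ for $1\le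 i\le n-1$, $G_i=\langle a_{i+1},\dots,a_n\rangle$ and $H_i=\langle a_{i+1},\dots,a_{n-1}\rangle$ for $0\le i\le n-1$. The cut-off point $c$ is the largest $s\in\{2,\dots,n\}$ with $[a_1,a_2]=\dots=[a_1,a_s]=e$; $G$ is then of $G(n,c)$-type. Lifting: if $\widehat G$ is an SSP group of length $n+1$ with canonical basis $(a_1,\dots,a_{n+1})$ and map $F$, then $\widehat H=\langle a_1,\dots,a_n\rangle$ is an SSP group with respect to $(\widehat H,\langle a_1,\dots,a_{n-1}\rangle,F|)$ with canonical basis $(a_1,\dots,a_n)$; $\widehat G$ is called a lifting of $\widehat H$. Arithmetic notation: write $n=3q(n)+r(n)$ with integers $q(n)\ge0$, $0\le r(n)\le2$, and put $c(n,j)=2q(n)+r(n)+j$ for $0\le j\le q(n)$. *)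

(* Defs.v *)
(* Groups here may be infinite (polycyclic, p = oo), so we use an abstract
   group structure with Prop-valued subsets instead of finGroupType. *)
From mathcomp Require Import all_boot.
Set Implicit Arguments. Unset Strict Implicit. Unset Printing Implicit Defensive.

Record group := Group {
  carrier :> Type;
  gmul : carrier -> carrier -> carrier;
  ginv : carrier -> carrier;
  gone : carrier;
  gmulA : forall x y z, gmul x (gmul y z) = gmul (gmul x y) z;
  gmul1 : forall x, gmul gone x = x;
  gmulV : forall x, gmul (ginv x) x = gone }.

Arguments gmul {g}. Arguments ginv {g}. Arguments gone {g}.

Section GroupDefs.
Variable T : group.

Definition gset := T -> Prop.
Definition gsetT : gset := fun _ => True.

Definition comm (x y : T) : T := gmul (gmul (ginv x) (ginv y)) (gmul x y).

Fixpoint gpow (x : T) (n : nat) : T :=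
  match n with 0 => gone | n'.+1 => gmul x (gpow x n') end.

Definition subset (A B : gset) := forall x, A x -> B x.
Definition seteq (A B : gset) := forall x, A x <-> B x.
Definition trivial (A : gset) := forall x, A x -> x = gone.
Definition setI (A B : gset) : gset := fun x => A x /\ B x.
Definition setmul (A B : gset) : gset :=
  fun z => exists x y, A x /\ B y /\ z = gmul x y.
Definition image (f : T -> T) (A : gset) : gset := fun y => exists x, A x /\ y = f x.

Definition is_subgroup (A : gset) :=
  A gone /\ (forall x y, A x -> A y -> A (gmul x y)) /\ (forall x, A x -> A (ginv x)).

Definition normal (A B : gset) :=
  is_subgroup A /\ subset A B /\
  forall b x, B b -> A x -> A (gmul (ginv b) (gmul x b)).

Definition gen (S : gset) : gset :=
  fun x => forall K, is_subgroup K -> subset S K -> K x.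

(* <a_i, ..., a_j> (trivial group when j < i) *)
Definition gen_range (a : nat -> T) (i j : nat) : gset :=
  gen (fun x => exists k, i <= k <= j /\ x = a k).

Definition hom_on (A B : gset) (f : T -> T) :=
  (forall x, A x -> B (f x)) /\
  (forall x y, A x -> A y -> f (gmul x y) = gmul (f x) (f y)).

Definition inj_on (A : gset) (f : T -> T) :=
  forall x y, A x -> A y -> f x = f y -> x = y.

Definition simple_triple (G H : gset) (f : T -> T) :=
  is_subgroup G /\ is_subgroup H /\ subset H G /\ hom_on H G f /\
  forall K, subset K H -> normal K G -> subset (image f K) K -> trivial K.

Fixpoint Gk (G H : gset) (f : T -> T) (k : nat) : gset :=
  match k with
  | 0 => G
  | k'.+1 => image f (setI H (Gk G H f k'))
  end.
Definition Hk (G H : gset) (f : T -> T) (k : nat) : gset := setI H (Gk G H f k).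

(* for B normal in A: A/B is cyclic, generated by the coset of g *)
Definition cyclic_quotient (A B : gset) (g : T) :=
  A g /\ forall x, A x -> exists n, B (gmul x (ginv (gpow g n))) \/ B (gmul x (gpow g n)).

(* p = Some p' : a prime p';  p = None : infinity *)
Definition order_cond (p : option nat) (n : nat) : Prop :=
  match p with Some p' => p' %| n | None => n = 0 end.

Definition quot_cyclic_order (p : option nat) (A B : gset) :=
  exists g, cyclic_quotient A B g /\ forall n, B (gpow g n) <-> order_cond p n.

Definition poly_series (G : gset) (S : nat -> gset) (m : nat) :=
  seteq (S 0) G /\ trivial (S m) /\
  forall i, i < m -> normal (S i.+1) (S i) /\ exists g, cyclic_quotient (S i) (S i.+1) g.

Definition polycyclic (G : gset) := is_subgroup G /\ exists S m, poly_series G S m.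

Definition infinite_factor (A B : gset) :=
  exists g, cyclic_quotient A B g /\ forall n, B (gpow g n) -> n = 0.

Definition hirsch_length (G : gset) (n : nat) :=
  exists S m (b : nat -> bool), poly_series G S m /\
    (forall i, i < m -> (b i <-> infinite_factor (S i) (S i.+1))) /\
    n = \sum_(i < m) (b i : nat).

Definition card_is (G : gset) (N : nat) :=
  exists h : 'I_N -> T, (forall i j, h i = h j -> i = j) /\
                        (forall x, G x <-> exists i, h i = x).

Definition has_length (p : option nat) (G : gset) (n : nat) :=
  match p with Some p' => card_is G (p' ^ n) | None => hirsch_length G n end.

Definition SSP (p : option nat) (G H : gset) (f : T -> T) :=
  polycyclic G /\
  inj_on H f /\
  (forall k, simple_triple (Gk G H f k) (Hk G H f k) f) /\
  (forall k, normal (Hk G H f k) (Gk G H f k) /\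
             normal (Gk G H f k.+1) (Gk G H f k) /\
             seteq (Gk G H f k) (setmul (Hk G H f k) (Gk G H f k.+1))) /\
  (forall k, ~ trivial (Gk G H f k) -> quot_cyclic_order p (Gk G H f k) (Hk G H f k)).

(* (a_1,...,a_n) is a canonical basis (indices 1..n of a : nat -> T) *)
Definition canonical_basis (G H : gset) (f : T -> T) (n : nat) (a : nat -> T) :=
  (forall i, 1 <= i <= n.-1 -> H (a i)) /\
  (forall i, 1 <= i <= n.-1 -> a i.+1 = f (a i)) /\
  (forall i, i <= n.-1 ->
     seteq (Gk G H f i) (gen_range a i.+1 n) /\
     seteq (Hk G H f i) (gen_range a i.+1 n.-1)).

Definition cutoff (n : nat) (a : nat -> T) (c : nat) :=
  2 <= c <= n /\
  (forall s, 2 <= s <= c -> comm (a 1) (a s) = gone) /\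
  (c < n -> comm (a 1) (a c.+1) <> gone).

Definition derived : gset := gen (fun z => exists x y, z = comm x y).
Definition metabelian :=
  forall x y, derived x -> derived y -> gmul x y = gmul y x.

End GroupDefs.

Arguments gsetT {T}.

Definition valid_p (p : option nat) : Prop := match p with Some p' => is_true (prime p') | None => True end.

Definition qn (n : nat) := n %/ 3.
Definition rn (n : nat) := n %% 3.
Definition cnj (n j : nat) := 2 * qn n + rn n + j.

Record sspg (p : option nat) := SSPG {
  sg : group;
  sH : gset sg;
  sf : sg -> sg;
  sspP : SSP p gsetT sH sf }.

(* L is a lifting of the SSP group T with respect to (T,H,f):
   L has length n+1 and a canonical basis (b_1,...,b_{n+1}), and
   <b_1,...,b_n> with respect to (<b_1..b_n>, <b_1..b_{n-1}>, F|) is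
   isomorphic (via phi) to (T,H,f). *)
Definition is_lifting (p : option nat) (L : sspg p) (T : group) (H : gset T) (f : T -> T) :=
  exists (n : nat) (b : nat -> sg L) (phi : sg L -> T),
    has_length p (@gsetT (sg L)) n.+1 /\
    canonical_basis gsetT (@sH p L) (@sf p L) n.+1 b /\
    (forall x y, gen_range b 1 n x -> gen_range b 1 n y ->
       phi (gmul x y) = gmul (phi x) (phi y)) /\
    (forall x y, gen_range b 1 n x -> gen_range b 1 n y -> phi x = phi y -> x = y) /\
    (forall y, exists x, gen_range b 1 n x /\ phi x = y) /\
    (forall y, H y <-> exists x, gen_range b 1 n.-1 x /\ phi x = y) /\
    (forall x, gen_range b 1 n.-1 x -> phi (@sf p L x) = f (phi x)).

(* Main.v *)
(* Write D_k for the domain of f^k.  On D_k the map f^k is injective and shifts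
   the basis, a_i |-> a_{i+k}, so normality of G_{k+1} and H_k in G_k gives
   [a_i, a_j] in <a_{i+1}, ..., a_{j-1}>, and basis elements at distance less
   than c commute.  Let w = [a_1, a_{c+1}], an element of the abelian group
   <a_2, ..., a_c>.  If w involved a_k with k <= n - c, then w would not commute
   with a_{k+c}; but comparing the two ways of moving a_1 past the commuting pair
   a_{c+1}, a_{k+c} shows that it does.  The mirror argument bounds the top index,
   whence w lies in <a_{n-c+1}, ..., a_{2c-n+1}>; as w <> 1 this forces 2n <= 3c.
   For a tower of m liftings with top group of length N = n + m, the bottom group
   is isomorphic to D_m of the top, so the cut-off point of the top is less than
   n, and 2(n + m) <= 3n bounds m. *)
Require Import Defs.
From mathcomp Require Import all_boot.
From mathcomp Require Import zify.
From Stdlib Require Import Classical.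

Set Implicit Arguments.
Unset Strict Implicit.
Unset Printing Implicit Defensive.

Local Notation "x ** y" := (gmul x y) (at level 40, left associativity).
Local Notation "x ^-1" := (ginv x).

(** * Commutators, powers, cyclic quotients and subgroups generated by consecutive basis elements *)

Section GroupTheory.
Variable T : group.
Implicit Types (x y z s b : T) (a : nat -> T).

Lemma gmulKl x y : x^-1 ** (x ** y) = y.
Proof. by rewrite gmulA gmulV gmul1. Qed.

Lemma gmulI x y z : x ** y = x ** z -> y = z.
Proof. by move=> /(congr1 (gmul x^-1)); rewrite !gmulKl. Qed.

Lemma gmulr1 x : x ** gone = x.
Proof. by apply: (@gmulI x^-1); rewrite gmulKl gmulV. Qed.

Lemma gmulrV x : x ** x^-1 = gone.
Proof. by apply: (@gmulI x^-1); rewrite gmulKl gmulr1. Qed.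

Lemma gmulKVl x y : x ** (x^-1 ** y) = y.
Proof. by rewrite gmulA gmulrV gmul1. Qed.

Lemma gmulK x y : x ** y ** y^-1 = x.
Proof. by rewrite -gmulA gmulrV gmulr1. Qed.

Lemma gmulKV x y : x ** y^-1 ** y = x.
Proof. by rewrite -gmulA gmulV gmulr1. Qed.

Lemma ginv_uniq x y : x ** y = gone -> y = x^-1.
Proof. by move=> xy; apply: (@gmulI x); rewrite xy gmulrV. Qed.

Lemma ginvK x : x^-1^-1 = x.
Proof. by apply/esym/ginv_uniq; rewrite gmulV. Qed.

Lemma ginv1 : (gone : T)^-1 = gone.
Proof. by apply/esym/ginv_uniq; rewrite gmul1. Qed.

Lemma ginvM x y : (x ** y)^-1 = y^-1 ** x^-1.
Proof. by apply/esym/ginv_uniq; rewrite gmulA gmulK gmulrV. Qed.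

Definition commute x y := x ** y = y ** x.

Lemma commute_sym x y : commute x y -> commute y x.
Proof. exact: esym. Qed.

(** As a subgroup, the centralizer can serve as the [K] of [gen_range_ind], which reduces
    commutation to generators. *)
Lemma commute_centralizer y : is_subgroup (fun x => commute x y).
Proof.
split; first by rewrite /commute gmul1 gmulr1.
split=> [x z Cx Cz | x Cx]; first by rewrite /commute -gmulA Cz !gmulA Cx.
by apply: (@gmulI x); rewrite gmulKVl !gmulA Cx gmulK.
Qed.

Lemma commuteM x y z : commute x z -> commute y z -> commute (x ** y) z.
Proof. by have [_ [+ _]] := commute_centralizer z; apply. Qed.

Lemma commuteV x z : commute x z -> commute x^-1 z.
Proof. by have [_ [_ +]] := commute_centralizer z; apply. Qed.

Lemma commute_pow x z k : commute x z -> commute (gpow x k) z.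
Proof.
move=> Cxz; elim: k => [|k IH] /=; last exact: commuteM.
by rewrite /commute gmul1 gmulr1.
Qed.

Lemma commgE x y : x ** y = y ** x ** comm x y.
Proof. by rewrite /comm !gmulA gmulK gmulrV gmul1. Qed.

Lemma comm1P x y : comm x y = gone <-> commute x y.
Proof.
split=> [C | C]; first by rewrite /commute commgE C gmulr1.
by apply: (@gmulI (y ** x)); rewrite -commgE gmulr1.
Qed.

Lemma commV x y : comm x y = (comm y x)^-1.
Proof. by rewrite /comm !ginvM !ginvK !gmulA. Qed.

(* A degenerate case of the Hall-Witt identity: compare the two ways of
   moving s past the commuting pair y, z. *)
Lemma commute_comm s y z :
    commute y z -> commute (comm s z) y -> commute (comm s z) (comm s y) ->
  commute (comm s y) z.
Proof.
move=> Cyz Cvy Cvw; have Esy := commgE s y; have Esz := commgE s z.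
move: (comm s y) (comm s z) Cvy Cvw Esy Esz => w v Cvy Cvw Esy Esz.
apply: (@gmulI (y ** s)); rewrite gmulA -Esy.
rewrite -(gmulA s) Cyz gmulA Esz -(gmulA (z ** s)) Cvy -!gmulA (gmulA s y) Esy.
rewrite -!gmulA -Cvw (gmulA z y) -Cyz -gmulA; congr (_ ** _).
by rewrite !gmulA Esz.
Qed.

Lemma gpow1n k : gpow (gone : T) k = gone.
Proof. by elim: k => //= k ->; rewrite gmul1. Qed.

Lemma gpowD x k m : gpow x (k + m) = gpow x k ** gpow x m.
Proof. by elim: k => [|k IH] /=; rewrite ?gmul1 // IH gmulA. Qed.

Lemma gpowM x k m : gpow x (k * m) = gpow (gpow x k) m.
Proof. by elim: m => [|m IH]; rewrite ?muln0 // mulnS gpowD IH. Qed.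

Lemma gpowV x k : gpow x^-1 k = (gpow x k)^-1.
Proof.
elim: k => [|k IH] /=; first by rewrite ginv1.
by rewrite IH -ginvM; congr (_^-1); apply: commute_pow.
Qed.

(** When $s$ commutes with $w=[s,b]$, moving $s^k$ past $b$ gives $s^k b = b s^k w^k$, so
    $[s^k,b]=w^k$. *)
Lemma gpow_comm s b k :
  commute s (comm s b) -> commute (gpow s k) b -> gpow (comm s b) k = gone.
Proof.
have := commgE s b; move: (comm s b) => w Esb Csw Ckb.
have E m : gpow s m ** b = b ** (gpow s m ** gpow w m).
  elim: m => [|m IH] /=; first by rewrite gmul1 !gmulr1.
  rewrite -gmulA IH gmulA Esb -!gmulA; congr (_ ** (_ ** _)).
  by rewrite !gmulA; congr (_ ** _); apply/commute_sym/commute_pow.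
by apply: (@gmulI (b ** gpow s k)); rewrite -gmulA -E Ckb gmulr1.
Qed.

Lemma gen_subgroup (S : gset T) : is_subgroup (gen S).
Proof.
split; first by move=> K [].
split=> [x y Sx Sy K sK SK | x Sx K sK SK]; have [_ [KM KV]] := sK.
  by apply: KM; [apply: Sx | apply: Sy].
by apply: KV; apply: Sx.
Qed.

Lemma gen_range_gen a i j k : i <= k <= j -> gen_range a i j (a k).
Proof. by move=> ikj K _; apply; exists k. Qed.

Lemma gen_range_ind a i j (K : gset T) :
    is_subgroup K -> (forall k, i <= k <= j -> K (a k)) ->
  forall x, gen_range a i j x -> K x.
Proof. by move=> sK aK x; apply=> // _ [k [ikj ->]]; apply: aK. Qed.

Lemma gen_range_subset a i j i' j' :
  i' <= i -> j <= j' -> forall x, gen_range a i j x -> gen_range a i' j' x.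
Proof.
move=> lei lej; apply: gen_range_ind; first exact: gen_subgroup.
by move=> k ikj; apply: gen_range_gen; lia.
Qed.

Lemma gen_range_empty a i j : j < i -> forall x, gen_range a i j x -> x = gone.
Proof.
move=> ltji; apply: gen_range_ind; last by move=> k; lia.
by split=> //; split=> [x y -> -> | x ->]; rewrite ?gmul1 ?ginv1.
Qed.

Lemma gen_range_commute a i j k l :
    (forall u v, i <= u <= j -> k <= v <= l -> commute (a u) (a v)) ->
  forall x y, gen_range a i j x -> gen_range a k l y -> commute x y.
Proof.
move=> C x y Rx Ry.
apply: (gen_range_ind (commute_centralizer y) _ Rx) => u iuj.
apply/commute_sym/(gen_range_ind (commute_centralizer (a u)) _ Ry) => v kvl.
by apply/commute_sym/C.
Qed.

Lemma gen_range_split a i j m :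
    (forall u v, i <= u <= j -> i <= v <= j -> commute (a u) (a v)) ->
    i <= m.+1 -> m <= j ->
  forall x, gen_range a i j x ->
    exists y z, gen_range a i m y /\ gen_range a m.+1 j z /\ x = y ** z.
Proof.
move=> C lei lej.
have [L1 [LM LV]] := gen_subgroup (fun x => exists k, i <= k <= m /\ x = a k).
have [R1 [RM RV]] := gen_subgroup (fun x => exists k, m < k <= j /\ x = a k).
have CLR : forall y z, gen_range a i m y -> gen_range a m.+1 j z -> commute y z.
  by apply: gen_range_commute => u v *; apply: C; lia.
apply: gen_range_ind.
  split; first by exists gone, gone; rewrite gmul1.
  split=> [_ _ [y [z [Ly [Rz ->]]]] [y' [z' [Ly' [Rz' ->]]]] | _ [y [z [Ly [Rz ->]]]]].
    exists (y ** y'), (z ** z'); split; first exact: LM.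
    split; first exact: RM.
    rewrite -!gmulA; congr (_ ** _); rewrite !gmulA; congr (_ ** _).
    by apply/commute_sym/CLR.
  exists y^-1, z^-1; split; first exact: LV.
  by split; [exact: RV | rewrite (CLR y z) // ginvM].
move=> k ikj; case: (leqP k m) => km.
  by exists (a k), gone; split; [apply: gen_range_gen; lia | rewrite gmulr1].
by exists gone, (a k); split=> //; split; [apply: gen_range_gen; lia | rewrite gmul1].
Qed.

Lemma gen_range1 a k x :
  gen_range a k k x -> exists m, x = gpow (a k) m \/ x ** gpow (a k) m = gone.
Proof.
move=> Rx.
have [m [l E]] : exists m l, x ** gpow (a k) m = gpow (a k) l.
  (* Exponents are naturals, so a negative power is cleared by multiplying it away on the left-hand
     side. Commutation with [a k] is carried along because the product and inverse cases need it. *)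
  suff: exists m l, commute x (a k) /\ x ** gpow (a k) m = gpow (a k) l.
    by case=> m [l [_ E]]; exists m, l.
  move: x Rx; apply: gen_range_ind.
    split; first by exists 0, 0; rewrite /commute !gmul1 gmulr1.
    split=> [x y [m [l [Cx Ex]]] [m' [l' [Cy Ey]]] | x [m [l [Cx Ex]]]].
      exists (m + m'), (l + l'); split; first exact: commuteM.
      have Cym : commute y (gpow (a k) m) by apply/commute_sym/commute_pow.
      by rewrite !gpowD -Ex -Ey -!gmulA; congr (_ ** _); rewrite !gmulA Cym.
    by exists l, m; split; [apply: commuteV | rewrite -Ex gmulKl].
  by move=> u /andP[ku uk]; exists 0, 1; rewrite (_ : u = k) /=; [| lia].
case: (leqP m l) => ml; [exists (l - m); left | exists (m - l); right].
  move: E; rewrite -{1}(subnK ml) gpowD => /(congr1 (fun t => t ** (gpow (a k) m)^-1)).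
  by rewrite !gmulK.
move: E; rewrite -{1}(subnK (ltnW ml)) gpowD gmulA.
by move=> /(congr1 (fun t => t ** (gpow (a k) l)^-1)); rewrite gmulK gmulrV.
Qed.

(** By normality $x(x^k y^{-k})x^{-1}$ stays in $B$, and multiplying it by $xy^{-1}$ on the right
    gives $x^{k+1}y^{-k-1}$. *)
Lemma quot_pow (A B : gset T) x y k :
    normal B A -> A x -> is_subgroup A -> B (x ** y^-1) ->
  B (gpow x k ** (gpow y k)^-1).
Proof.
move=> [[B1 [BM _]] [_ BJ]] Ax [_ [_ AV]] Bxy.
elim: k => [|k IH] /=; first by rewrite ginv1 gmul1.
have /= := BM _ _ (BJ x^-1 _ (AV _ Ax) IH) Bxy.
by rewrite ginvK ginvM !gmulA gmulKV.
Qed.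

(** Replacing the generator by its inverse where necessary absorbs the two signs in
    [cyclic_quotient]. *)
Lemma quot_cyclic_gen p (A B : gset T) x :
    quot_cyclic_order p A B -> normal B A -> is_subgroup A -> A x ->
  exists g k, [/\ A g, B (x ** (gpow g k)^-1) & forall m, B (gpow g m) <-> order_cond p m].
Proof.
move=> [g [[Ag gen_g] ord_g]] [[_ [_ BV]] _] [_ [_ AV]] Ax.
have [k [Bx | Bx]] := gen_g x Ax; first by exists g, k.
exists g^-1, k; split; [exact: AV | by rewrite gpowV ginvK |] => m.
by rewrite -ord_g gpowV; split=> /BV; rewrite ?ginvK.
Qed.

End GroupTheory.

(** * Domains of the iterates of a partial endomorphism *)

Section IteratedDomain.
Variables (T : group) (H : gset T) (f : T -> T).
Implicit Types x y : T.

(** The domain $D_k$ of the partial map $f^k$: [f] is a total function but is meaningful only on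
    [H], so all points of the orbit before the last must lie in [H]. *)
Fixpoint iter_dom (k : nat) : gset T :=
  match k with
  | 0 => @gsetT T
  | k'.+1 => fun x => H x /\ iter_dom k' (f x)
  end.

Lemma iter_dom_Gk k x : iter_dom k x -> Gk gsetT H f k (iter k f x).
Proof.
(* [Gk] applies [f] on the outside while [iter_dom] peels off the first application, so the
   induction carries the [m] applications already made. *)
suff E m : iter_dom k (iter m f x) -> Gk gsetT H f m (iter m f x) ->
    Gk gsetT H f (k + m) (iter (k + m) f x) by move=> D; rewrite -(addn0 k); apply: E.
elim: k m => [|k IH] m // [Hx Dx] Gx.
by rewrite addSnnS; apply: IH => //; exists (iter m f x).
Qed.

Lemma iter_domSr k x : iter_dom k x -> H (iter k f x) -> iter_dom k.+1 x.
Proof.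
elim: k x => [|k IH] x //= [Hx Dx] Hfx; split=> //.
by apply: IH => //; rewrite -iterSr.
Qed.

Lemma iter_dom_last k x : iter_dom k.+1 x -> H (iter k f x).
Proof. by elim: k x => [|k IH] x [Hx Dx] //; rewrite iterSr; apply: IH. Qed.

Lemma iter_dom_le k m x : m <= k -> iter_dom k x -> iter_dom m x.
Proof.
elim: k m x => [|k IH] [|m] x //= mk [Hx Dx].
by split=> //; apply: IH Dx.
Qed.

Hypotheses (sH : is_subgroup H) (f_inj : inj_on H f).
Hypothesis fM : forall x y, H x -> H y -> f (x ** y) = f x ** f y.

Lemma hom1 : f gone = gone.
Proof.
have [H1 _] := sH; apply: (@gmulI _ (f gone)).
by rewrite -fM // gmul1 gmulr1.
Qed.

Lemma homV x : H x -> f x^-1 = (f x)^-1.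
Proof.
by move=> Hx; apply: ginv_uniq; rewrite -fM ?gmulrV ?hom1 //; apply sH.
Qed.

Lemma iter_hom1 k : iter k f gone = gone.
Proof. by elim: k => //= k ->; rewrite hom1. Qed.

Lemma iter_homM k x y :
  iter_dom k x -> iter_dom k y -> iter k f (x ** y) = iter k f x ** iter k f y.
Proof.
elim: k x y => [|k IH] x y // [Hx Dx] [Hy Dy].
by rewrite !iterSr fM // IH.
Qed.

Lemma iter_homV k x : iter_dom k x -> iter k f x^-1 = (iter k f x)^-1.
Proof. by elim: k x => [|k IH] x // [Hx Dx]; rewrite !iterSr homV // IH. Qed.

Lemma iter_dom_subgroup k : is_subgroup (iter_dom k).
Proof.
have [H1 [HM HV]] := sH.
elim: k => [|k [D1 [DM DV]]] //=.
split; first by rewrite hom1.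
split=> [x y [Hx Dx] [Hy Dy] | x [Hx Dx]].
  by split; [apply: HM | rewrite fM //; apply: DM].
by split; [apply: HV | rewrite homV //; apply: DV].
Qed.

Lemma iter_dom_pow k m x : iter_dom k x -> iter_dom k (gpow x m).
Proof.
by have [D1 [DM _]] := iter_dom_subgroup k => Dx; elim: m => //= m; apply: DM.
Qed.

Lemma iter_hom_pow k m x : iter_dom k x -> iter k f (gpow x m) = gpow (iter k f x) m.
Proof.
move=> Dx; elim: m => [|m IH] /=; first exact: iter_hom1.
by rewrite iter_homM ?IH //; apply: iter_dom_pow.
Qed.

Lemma iter_inj k x y :
  iter_dom k x -> iter_dom k y -> iter k f x = iter k f y -> x = y.
Proof.
elim: k x y => [|k IH] x y // [Hx Dx] [Hy Dy].
by rewrite !iterSr => /IH E; apply: f_inj => //; apply: E.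
Qed.

End IteratedDomain.

(** * Shifting along the canonical basis *)

Section CanonicalBasis.
Variables (p : option nat) (T : group) (H : gset T) (f : T -> T).
Variables (n : nat) (a : nat -> T).
Implicit Types x y : T.
Hypotheses (ssp : SSP p gsetT H f) (basis : canonical_basis gsetT H f n a).
Local Notation G := (Gk gsetT H f).
Local Notation D := (iter_dom H f).

Lemma ssp_subgroup : is_subgroup H.
Proof.
have [_ [_ [/(_ 0)[_ [+ _]] _]]] := ssp.
case=> [[H1 _] [HM HV]]; split=> //.
split=> [x y Hx Hy | x Hx]; first by have [] := HM x y.
by have [] := HV x.
Qed.

Lemma ssp_hom x y : H x -> H y -> f (x ** y) = f x ** f y.
Proof.
have [_ [_ [/(_ 0)[_ [_ [_ [[_ fM] _]]]] _]]] := ssp.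
by move=> Hx Hy; apply: fM.
Qed.

Lemma ssp_inj : inj_on H f.
Proof. by have [_ []] := ssp. Qed.

Lemma ssp_Gk_subgroup k : is_subgroup (G k).
Proof. by have [_ [_ [/(_ k)[]]]] := ssp. Qed.

Let D_subgroup k : is_subgroup (D k) := iter_dom_subgroup ssp_subgroup ssp_hom k.
Let iterM k := @iter_homM _ _ _ ssp_hom k.
Let iterV k := @iter_homV _ _ _ ssp_subgroup ssp_hom k.
Let iter_pow k := @iter_hom_pow _ _ _ ssp_subgroup ssp_hom k.
Let f_iter_inj k := @iter_inj _ _ _ ssp_inj k.
Let iter1 k := iter_hom1 ssp_subgroup ssp_hom k.

Lemma basis_shift i k :
  0 < i -> i + k <= n -> D k (a i) /\ iter k f (a i) = a (i + k).
Proof.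
have [aH [af _]] := basis.
elim: k i => [|k IH] i i0 ikn; first by rewrite addn0.
have in1 : 1 <= i <= n.-1 by lia.
have [|Da fa] := IH i.+1 isT; first by lia.
by rewrite iterSr /= -af // fa addSnnS; split=> //; split=> //; apply: aH.
Qed.

Lemma range_iter_dom i j k x :
  0 < i -> j + k <= n -> gen_range a i j x -> D k x.
Proof.
move=> i0 jkn; move: x; apply: gen_range_ind; first exact: D_subgroup.
by move=> u iuj; have [] := @basis_shift u k; try lia.
Qed.

Lemma range_shift i j k x :
    0 < i -> j + k <= n -> gen_range a i j x ->
  gen_range a (i + k) (j + k) (iter k f x).
Proof.
move=> i0 jkn Rx.
have [R1 [RM RV]] := gen_subgroup (fun x => exists u, i + k <= u <= j + k /\ x = a u).
have [D1 [DM DV]] := D_subgroup k.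
suff [] : D k x /\ gen_range a (i + k) (j + k) (iter k f x) by [].
move: x Rx; apply: gen_range_ind.
  split; first by rewrite iter1.
  split=> [x y [Dx Rx] [Dy Ry] | x [Dx Rx]].
    by split; [apply: DM | rewrite iterM //; apply: RM].
  by split; [apply: DV | rewrite iterV //; apply: RV].
move=> u iuj; have [||Da ->] := @basis_shift u k; try lia.
by split=> //; apply: gen_range_gen; lia.
Qed.

Lemma range_unshift i j k y :
    0 < i -> j + k <= n -> gen_range a (i + k) (j + k) y ->
  exists x, gen_range a i j x /\ y = iter k f x.
Proof.
move=> i0 jkn.
have [R1 [RM RV]] := gen_subgroup (fun x => exists u, i <= u <= j /\ x = a u).
have RD x : gen_range a i j x -> D k x by apply: range_iter_dom.
move: y; apply: gen_range_ind.
  split; first by exists gone; rewrite iter1.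
  split=> [_ _ [x [Rx ->]] [y [Ry ->]] | _ [x [Rx ->]]].
    by exists (x ** y); split; [apply: RM | rewrite iterM //; apply: RD].
  by exists x^-1; split; [apply: RV | rewrite iterV //; apply: RD].
move=> u iuj; have [||] := @basis_shift (u - k) k; try lia.
move=> _ E; exists (a (u - k)); split; first by apply: gen_range_gen; lia.
by rewrite E subnK //; lia.
Qed.

(** The image $f^k(x)$ lies in $G_k=\langle a_{k+1},\dots,a_n\rangle$; shift this range back by $k$
    and use injectivity of $f^k$. *)
Lemma iter_dom_range k x : k < n -> D k x -> gen_range a 1 (n - k) x.
Proof.
have [_ [_ GH]] := basis.
move=> kn Dx; have [|Gk_range _] := GH k; first by lia.
have Rfx : gen_range a (1 + k) (n - k + k) (iter k f x).
  by rewrite subnK ?(ltnW kn) //; apply/Gk_range/iter_dom_Gk.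
have nk : n - k + k <= n by rewrite subnK // ltnW.
have [//|y [Ry E]] := range_unshift _ nk Rfx.
by rewrite (f_iter_inj Dx _ E) //; apply: range_iter_dom Ry.
Qed.

(** Here $f^{n-1}(x)$ lies in $H_{n-1}$, which is generated by an empty range. *)
Lemma iter_dom_length x : 0 < n -> D n x -> x = gone.
Proof.
have [_ [_ GH]] := basis.
move=> n0 Dx; have [//|_ Hk_range] := GH n.-1.
have Dx' : D n.-1 x by apply: iter_dom_le Dx; lia.
apply: (f_iter_inj Dx'); first exact: (proj1 (D_subgroup n.-1)).
rewrite iter1; apply: (@gen_range_empty _ a n.-1.+1 n.-1) => //.
apply/Hk_range; split; last exact: iter_dom_Gk.
by apply: iter_dom_last; rewrite prednK.
Qed.

(** Only the top index is cut off by $H$, so shift by $t=n-j$ to turn $a_j$ into $a_n$. With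
    $k+1=i+t$, the elements $a_{k+1}\in H_k$ and $a_n\in G_{k+1}$ have their commutator in $H\cap
    G_{k+1}=H_{k+1}$, both subgroups being normal in $G_k$. Then shift back. *)
Lemma comm_basis_range i j :
  0 < i < j -> j <= n -> gen_range a i.+1 j.-1 (comm (a i) (a j)).
Proof.
have [aH [_ GH]] := basis.
move=> ij jn; set t := n - j.
have [||Di Ei] := @basis_shift i t; try lia.
have [||Dj Ej] := @basis_shift j t; try lia.
have {}Ej : iter t f (a j) = a n by rewrite Ej; congr (a _); lia.
have [D1 [DM DV]] := D_subgroup t.
have Dcomm : D t (comm (a i) (a j)).
  by rewrite /comm; apply: (DM); apply: (DM) => //; apply: DV.
have Ecomm : iter t f (comm (a i) (a j)) = comm (a (i + t)) (a n).
  by rewrite /comm !iterM ?iterV ?Ei ?Ej //; try apply: DM; try apply: DV.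
suff Rcomm : gen_range a (i.+1 + t) (j.-1 + t) (comm (a (i + t)) (a n)).
  have [||x [Rx Ex]] := range_unshift _ _ Rcomm; try lia.
  rewrite (f_iter_inj Dcomm _ (_ : _ = iter t f x)) ?Ecomm //.
  by apply: range_iter_dom Rx; lia.
have it1 : 0 < i + t by lia.
pose k := (i + t).-1.
have Ek : k.+1 = i + t by rewrite prednK.
have [|_ Hr] := GH k.+1; first by lia.
have -> : j.-1 + t = n.-1 by lia.
rewrite addSn -{1}Ek; apply/Hr; clear Hr.
have [|Gr _] := GH k; first by lia.
have [|Gr' _] := GH k.+1; first by lia.
have Gi : G k (a (i + t)) by apply/Gr; apply: gen_range_gen; lia.
have Gn : G k.+1 (a n) by apply/Gr'; apply: gen_range_gen; lia.
have Gn' : G k (a n) by apply/Gr; apply: gen_range_gen; lia.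
have Hi : Hk gsetT H f k (a (i + t)) by split=> //; apply: aH; lia.
have [_ [_ [_ [/(_ k)[[[_ [HM HV]] [_ HJ]] [[[_ [GM GV]] [_ GJ]] _]] _]]]] := ssp.
split.
  have [+ _] := HM _ _ (HV _ Hi) (HJ _ _ Gn' Hi).
  by rewrite /comm !gmulA.
have := GM _ _ (GJ _ _ Gi (GV _ Gn)) Gn.
by rewrite /comm !gmulA.
Qed.

(** * Commutation of basis elements at distance less than [c] *)

Variable c : nat.
Hypothesis comm_le : forall s, 2 <= s <= c -> comm (a 1) (a s) = gone.

(** For $i<j$ this is the relation $[a_1,a_{j-i+1}]=e$ shifted by $i-1$. *)
Lemma basis_commute i j :
  0 < i <= n -> 0 < j <= n -> i < j + c -> j < i + c -> commute (a i) (a j).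
Proof.
wlog ij : i j / i < j => [IH | ] in1 jn1 ijc jic.
  case: (ltngtP i j) => [ij | ij | ->]; [exact: IH | | by []].
  by apply: commute_sym; apply: IH.
have [||D1 E1] := @basis_shift 1 i.-1; try lia.
have [||Ds Es] := @basis_shift (j - i).+1 i.-1; try lia.
have {}E1 : iter i.-1 f (a 1) = a i by rewrite E1; congr (a _); lia.
have {}Es : iter i.-1 f (a (j - i).+1) = a j by rewrite Es; congr (a _); lia.
rewrite /commute -E1 -Es -!iterM //; congr (iter _ f _).
by apply/comm1P; apply: comm_le; lia.
Qed.

Lemma range_commute i j k l x y :
    0 < i -> j <= n -> 0 < k -> l <= n -> j < k + c -> l < i + c ->
  gen_range a i j x -> gen_range a k l y -> commute x y.
Proof.
by move=> *; apply: (@gen_range_commute _ a i j k l) => // u v *; apply: basis_commute; lia.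
Qed.

(** * Torsion in a nontrivial SSP group *)

Hypotheses (p_valid : valid_p p) (x0 : T) (x0_neq1 : x0 <> gone) (n_gt0 : 0 < n).

(** Each such $G_k$ contains $a_n$. If $a_n$ were trivial, injectivity of $f^{n-i}$ on $a_i\mapsto
    a_n$ would kill every generator, hence [x0]. *)
Lemma Gk_nontrivial k : k < n -> ~ Defs.trivial (G k).
Proof.
have [_ [_ GH]] := basis.
move=> kn tG; apply: x0_neq1.
have [//|Gk_range _] := GH 0.
have /Gk_range : G 0 x0 by [].
apply: (@gen_range_ind _ a 1 n (fun x => x = gone)).
  by split=> //; split=> [x y -> -> | x ->]; rewrite ?gmul1 ?ginv1.
move=> i in1; have [||Da E] := @basis_shift i (n - i); try lia.
apply: (f_iter_inj Da); first exact: (proj1 (D_subgroup _)).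
rewrite E iter1 (_ : i + (n - i) = n); last by lia.
have [|Gk_range' _] := GH k; first by lia.
by apply: tG; apply/Gk_range'; apply: gen_range_gen; rewrite kn leqnn.
Qed.

Lemma basis1_neq1 : a 1 <> gone.
Proof.
have [_ [_ GH]] := basis; have [//|Gn_range _] := GH n.-1.
move=> a1; apply: (@Gk_nontrivial n.-1); first by lia.
move=> x /Gn_range Rx.
have an : a n = gone.
  have [||_ E] := @basis_shift 1 n.-1; try lia.
  by rewrite -(_ : 1 + n.-1 = n) -?E ?a1 ?iter1 //; lia.
rewrite prednK // in Rx; have [m] := gen_range1 Rx.
by rewrite an gpow1n gmulr1; case.
Qed.

Lemma order_condM (m k : nat) : order_cond p (m * k) -> order_cond p m \/ order_cond p k.
Proof.
case: p p_valid => [q|] /= q_pr; last by lia.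
by rewrite Euclid_dvdM // => /orP.
Qed.

(** In the cyclic quotient $G_k/H_k$, of prime or infinite order, $g^{lm}$ is trivial only if $g^l$
    is or $m$ satisfies [order_cond]. *)
Lemma Gk_root k m x : k < n -> G k x -> H (gpow x m) -> H x \/ order_cond p m.
Proof.
move=> kn Gx Hxm.
have [_ [_ [_ [/(_ k)[nH _] /(_ k (Gk_nontrivial kn)) cyc]]]] := ssp.
have sG := ssp_Gk_subgroup k.
have [g [l [Gg Bx ord_g]]] := quot_cyclic_gen cyc nH sG Gx.
have [[_ [BM BV]] _] := nH.
have Gpow y i : G k y -> G k (gpow y i).
  by move=> Gy; have [G1 [GM _]] := sG; elim: i => //= i IH; apply: GM.
have Bxm := quot_pow m nH Gx sG Bx.
have : Hk gsetT H f k (gpow (gpow g l) m).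
  have := BM _ _ (BV _ Bxm) (conj Hxm (Gpow x m Gx)).
  by rewrite ginvM ginvK gmulKV.
rewrite -gpowM => /ord_g /order_condM[/ord_g Bg | ]; [left | by right].
by have [] := BM _ _ Bx Bg; rewrite gmulKV.
Qed.

(** If [order_cond p m] fails, [x] climbs through all the domains: $f^k(x)^m=e$ lies in $H$, hence
    so does $f^k(x)$ by [Gk_root], and $x\in D_{k+1}$. But $D_n$ is trivial. *)
Lemma gpow_eq1 x m : gpow x m = gone -> x = gone \/ order_cond p m.
Proof.
move=> xm; case: (classic (order_cond p m)) => om; [by right | left].
apply: iter_dom_length => //.
suff: forall k, k <= n -> D k x by apply.
elim=> // k IH kn; have Dx := IH (ltnW kn).
apply: iter_domSr => //.
have [] // := @Gk_root k m _ kn (iter_dom_Gk Dx).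
by rewrite -iter_pow // xm iter1; case: ssp_subgroup.
Qed.

(** As $H_{n-1}$ is trivial, $G_{n-1}=\langle a_n\rangle$ is itself the cyclic quotient; the
    relation $a_n^m=e$ is pulled back along $f^{n-i}$. *)
Lemma gpow_basis i m : 0 < i <= n -> order_cond p m -> gpow (a i) m = gone.
Proof.
have [_ [_ GH]] := basis.
move=> in1 om.
have [//|Gn_range Hn_range] := GH n.-1.
have Gan : G n.-1 (a n) by apply/Gn_range; apply: gen_range_gen; rewrite prednK // leqnn.
have nn : n.-1 < n by lia.
have [_ [_ [_ [/(_ n.-1)[nH _] /(_ n.-1 (Gk_nontrivial nn)) cyc]]]] := ssp.
have sG := ssp_Gk_subgroup n.-1.
have [g [l [Gg Bx ord_g]]] := quot_cyclic_gen cyc nH sG Gan.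
have H1 x : Hk gsetT H f n.-1 x -> x = gone.
  by move/Hn_range; apply: gen_range_empty.
have Ean : a n = gpow g l.
  by have /(congr1 (fun t => t ** gpow g l)) := H1 _ Bx; rewrite gmulKV gmul1.
have Eanm : gpow (a n) m = gone.
  rewrite Ean -gpowM; apply/H1/ord_g.
  by case: p om => [q|] /= om; [apply: dvdn_mull | rewrite om muln0].
have [||Da E] := @basis_shift i (n - i); try lia.
apply: (@f_iter_inj (n - i)).
- exact: (iter_dom_pow ssp_subgroup ssp_hom).
- exact: (proj1 (D_subgroup _)).
by rewrite iter1 iter_pow // E subnKC ?Eanm //; lia.
Qed.

(** * The support of the first nontrivial commutator [w] *)

Hypotheses (c_gt0 : 0 < c) (c_ltn : c < n).
Let w := comm (a 1) (a c.+1).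
Hypothesis w_neq1 : w <> gone.

(** Since $w\in\langle a_2,\dots,a_c\rangle$ commutes with $a_1$, $[a_1^m,a_{c+1}]=w^m$, and $w\neq
    e$. *)
Lemma gpow_basis_commute1 m : commute (gpow (a 1) m) (a c.+1) -> order_cond p m.
Proof.
move=> Cm; have Rw := @comm_basis_range 1 c.+1 c_gt0 c_ltn.
have C1w : commute (a 1) w.
  apply: (@range_commute 1 1 2 c _ _ _ _ _ _ _ _ _ Rw); try lia.
  by apply: gen_range_gen.
by have [] := gpow_eq1 (gpow_comm C1w Cm).
Qed.

Lemma gpow_basis_commuteS m : commute (gpow (a c.+1) m) (a 1) -> order_cond p m.
Proof.
move=> Cm; have Rw := @comm_basis_range 1 c.+1 c_gt0 c_ltn.
have Ew : comm (a c.+1) (a 1) = w^-1 by apply: commV.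
have C1w : commute (a c.+1) (comm (a c.+1) (a 1)).
  rewrite Ew; apply/commute_sym/commuteV.
  apply: (@range_commute 2 c c.+1 c.+1 _ _ _ _ _ _ _ _ Rw); try lia.
  by apply: gen_range_gen; lia.
have [|//] := gpow_eq1 (gpow_comm C1w Cm); rewrite Ew => /(congr1 ginv).
by rewrite ginvK ginv1.
Qed.

(** Both $w$ and its part in $\langle a_{k+1},\dots,a_c\rangle$ commute with $a_{k+c}$, hence so
    does the remaining factor $a_k^{\pm m}$. Shifted back by $k-1$, this says that $a_1^m$ commutes
    with $a_{c+1}$, which forces $a_k^m=e$. *)
Lemma comm_range_lower k :
    2 <= k <= n - c -> k <= c ->
  gen_range a k c w -> gen_range a k.+1 c w.
Proof.
move=> kn kc Rw; set z := a (k + c).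
have Rz : gen_range a (k + c) (k + c) z by apply: gen_range_gen; lia.
have Cwz : commute w z.
  have Rv := @comm_basis_range 1 (k + c) (_ : 0 < 1 < k + c) (_ : k + c <= n).
  have {}Rv : gen_range a 2 (k + c).-1 (comm (a 1) z) by apply: Rv; lia.
  have Rc : gen_range a c.+1 c.+1 (a c.+1) by apply: gen_range_gen; lia.
  apply: commute_comm.
  - by apply: (range_commute _ _ _ _ _ _ Rc Rz); lia.
  - by apply: (range_commute _ _ _ _ _ _ Rv Rc); lia.
  (* The top index $k+c-1$ of $[a_1,a_{k+c}]$ is at distance $c-1$ from $k$: exactly here [w] must
     have no generator below $a_k$. *)
  - by apply: (range_commute _ _ _ _ _ _ Rv Rw); lia.
have [|||y [u [Ry [Ru Ew]]]] := @gen_range_split _ a k c k _ _ _ w Rw; try lia.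
  by move=> *; apply: basis_commute; lia.
have Cuz : commute u z by apply: (range_commute _ _ _ _ _ _ Ru Rz); lia.
have Cyz : commute y z.
  by rewrite -(gmulK y u) -Ew; apply: commuteM => //; apply: commuteV.
have [m Em] := gen_range1 Ry.
have Cm : commute (gpow (a k) m) z.
  case: Em => [<- // | /ginv_uniq ->]; exact: commuteV.
have om : order_cond p m.
  apply: gpow_basis_commute1.
  have [||D1 E1] := @basis_shift 1 k.-1; try lia.
  have [||Dc Ec] := @basis_shift c.+1 k.-1; try lia.
  have Dm : D k.-1 (gpow (a 1) m) by apply: (iter_dom_pow ssp_subgroup ssp_hom).
  have [_ [DM _]] := D_subgroup k.-1.
  apply: (@f_iter_inj k.-1); [exact: DM | exact: DM |].
  have {}E1 : iter k.-1 f (a 1) = a k by rewrite E1; congr (a _); lia.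
  have {}Ec : iter k.-1 f (a c.+1) = z by rewrite Ec; congr (a _); lia.
  by rewrite !iterM // iter_pow // E1 Ec.
have y1 : y = gone.
  by case: Em; rewrite gpow_basis // ?gmulr1 //; lia.
by rewrite Ew y1 gmul1.
Qed.

(** Mirror image of [comm_range_lower]: the shifted commutator $f^t(w)$ commutes with $a_1$, so its
    top factor $a_{c+1}^{\pm m}$ does too. *)
Lemma comm_range_upper k l :
    2 <= k <= l -> l <= c -> 2 * c + 2 <= n + l ->
  gen_range a k l w -> gen_range a k l.-1 w.
Proof.
(* This shift takes $a_l$ to $a_{c+1}$; the bound [ln] says that $a_{c+1+t}$ is still a basis
   element. *)
move=> kl lc ln Rw; pose t := c.+1 - l.
have [||D1 E1] := @basis_shift 1 t; try lia.
have [||Dc Ec] := @basis_shift c.+1 t; try lia.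
have [D0 [DM DV]] := D_subgroup t.
have Rwt : gen_range a (k + t) (l + t) (iter t f w) by apply: range_shift => //; lia.
have Ewt : iter t f w = comm (a (1 + t)) (a (c.+1 + t)).
  by rewrite /w /comm !iterM ?iterV ?E1 ?Ec //; try apply: DM; try apply: DV.
set y := a (1 + t) in Ewt *; set s := a (c.+1 + t) in Ewt *.
have Ry : gen_range a (1 + t) (1 + t) y by apply: gen_range_gen; lia.
have Rz : gen_range a 1 1 (a 1) by apply: gen_range_gen.
have Cwz : commute (iter t f w) (a 1).
  have Rv : gen_range a 2 (c + t) (comm s (a 1)).
    rewrite commV; apply: (proj2 (proj2 (gen_subgroup _))).
    by apply: (@comm_basis_range 1 (c.+1 + t)); lia.
  rewrite Ewt commV; apply: commuteV; apply: commute_comm.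
  - by apply: (range_commute _ _ _ _ _ _ Ry Rz); lia.
  - by apply: (range_commute _ _ _ _ _ _ Rv Ry); lia.
  - rewrite (commV s y) -Ewt; apply/commute_sym/commuteV.
    by apply: (range_commute _ _ _ _ _ _ Rwt Rv); lia.
have [|||u [x [Ru [Rx Ew]]]] := @gen_range_split _ a k l l.-1 _ _ _ w Rw; try lia.
  by move=> *; apply: basis_commute; lia.
rewrite prednK in Rx; last by lia.
have Du : D t u by apply: range_iter_dom Ru; lia.
have Rut : gen_range a (k + t) (l.-1 + t) (iter t f u) by apply: range_shift => //; lia.
have Dx : D t x by apply: range_iter_dom Rx; lia.
have [||Dl El] := @basis_shift l t; try lia.
have Cut : commute (iter t f u) (a 1).
  by apply: (range_commute _ _ _ _ _ _ Rut Rz); lia.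
have Cxt : commute (iter t f x) (a 1).
  rewrite -(gmulKl (iter t f u) (iter t f x)) -iterM // -Ew.
  by apply: commuteM => //; apply: commuteV.
have [m Em] := gen_range1 Rx.
have Dlm : D t (gpow (a l) m) by apply: (iter_dom_pow ssp_subgroup ssp_hom).
have om : order_cond p m.
  apply: gpow_basis_commuteS.
  have -> : a c.+1 = iter t f (a l) by rewrite El; congr (a _); lia.
  rewrite -iter_pow //.
  by case: Em => [<- // | /ginv_uniq ->]; rewrite iterV //; apply: commuteV.
have x1 : x = gone.
  by case: Em; rewrite gpow_basis // ?gmulr1 //; lia.
by rewrite Ew x1 gmulr1.
Qed.

(** Generators are stripped one at a time from below and then from above; the range never becomes
    empty because $w\neq e$, and its being nonempty at the end is the inequality. *)
Lemma comm_basis_support : gen_range a (n - c).+1 (2 * c - n).+1 w /\ 2 * n <= 3 * c.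
Proof.
have Rw := @comm_basis_range 1 c.+1 c_gt0 c_ltn.
have low k : 0 < k <= n - c -> gen_range a k.+1 c w.
  elim: k => // -[_ _ // | k] IH kn.
  have {}IH := IH (_ : 0 < k.+1 <= n - c).
  have {}IH : gen_range a k.+2 c w by apply: IH; lia.
  case: (leqP k.+2 c) => kc; first by apply: comm_range_lower => //; lia.
  by case: w_neq1; apply: gen_range_empty IH.
have up d : d + (2 * c - n).+1 <= c -> gen_range a (n - c).+1 (c - d) w.
  elim: d => [|d IH] dc; first by rewrite subn0; apply: low; lia.
  have {}IH : gen_range a (n - c).+1 (c - d) w by apply: IH; lia.
  case: (leqP (n - c).+1 (c - d)) => kc.
    by rewrite subnS; apply: comm_range_upper => //; lia.
  by case: w_neq1; apply: gen_range_empty IH.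
have Rw' : gen_range a (n - c).+1 (2 * c - n).+1 w.
  have -> : (2 * c - n).+1 = c - (c - (2 * c - n).+1) by lia.
  by apply: up; lia.
(* Truncation of [2 * c - n] is harmless: if it is 0, then $c<n$ already makes the range empty. *)
split=> //; case: (leqP (n - c).+1 (2 * c - n).+1) => lt; first by lia.
by case: w_neq1; apply: gen_range_empty Rw'.
Qed.

End CanonicalBasis.

(** If basis elements at distance less than $n-m$ all commuted, $D_m=\langle
    a_1,\dots,a_{n-m}\rangle$ would be abelian. So some $c<n-m$ acts as cut-off point, and $2n\le
    3c$ gives the bound. *)
Lemma noncommutative_length p (T : group) (H : gset T) (f : T -> T) n a m x y :
    valid_p p -> SSP p gsetT H f -> canonical_basis gsetT H f n a ->
    iter_dom H f m x -> iter_dom H f m y -> ~ commute x y ->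
  0 < n /\ 3 * m <= n.
Proof.
move=> p_valid ssp basis Dx Dy NCxy.
have x_neq1 : x <> gone by move=> x1; apply: NCxy; rewrite x1 /commute gmul1 gmulr1.
have n_gt0 : 0 < n.
  case: n basis => // -[_ [_ /(_ 0 isT)[Gr _]]]; case: x_neq1.
  by apply: (@gen_range_empty _ a 1 0) => //; apply/Gr.
split=> //.
have m_ltn : m < n.
  rewrite ltnNge; apply/negP => nm; apply: x_neq1.
  by apply: (iter_dom_length ssp basis) => //; apply: iter_dom_le Dx.
(* The value $c=1$ is allowed here, when already $[a_1,a_2]\neq e$. *)
have [[c [c_gt0 [c_lt [c_le c_neq]]]] | none] := classic (exists c, 0 < c /\ c < n - m /\
    (forall s, 2 <= s <= c -> comm (a 1) (a s) = gone) /\ comm (a 1) (a c.+1) <> gone).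
  have c_ltn : c < n by lia.
  by have [_] := comm_basis_support ssp basis c_le p_valid x_neq1 n_gt0 c_gt0 c_ltn c_neq; lia.
have comm_le : forall s, 2 <= s <= n - m -> comm (a 1) (a s) = gone.
  suff C : forall c, c <= n - m -> forall s, 2 <= s <= c -> comm (a 1) (a s) = gone by exact: C.
  elim=> [|c IH] cn s sc; first by lia.
  have [|sc'] := leqP s c; first by move=> sc'; apply: IH; lia.
  apply: NNPP => NC; apply: none; exists c; split; first by lia.
  split=> //; split; first by apply: IH; lia.
  by move=> E; apply: NC; rewrite (_ : s = c.+1) //; lia.
case: NCxy; apply: (range_commute ssp basis comm_le (i := 1) (j := n - m) (k := 1) (l := n - m)).
all: try by lia.
all: exact: (iter_dom_range ssp basis).
Qed.

(** * Transport of domains along a lifting *)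

Section Lifting.
Variables (p : option nat) (L : sspg p) (T : group) (H : gset T) (f : T -> T).
Hypothesis lifting : is_lifting L H f.

(** The domain of the map of [L] is $\langle b_1,\dots,b_n\rangle$, the copy of [T] inside [L];
    hence one lifting raises the index of each domain by one. *)
Lemma lifting_iso : exists phi : sg L -> T,
  [/\ forall x y, sH x -> sH y -> phi (x ** y) = phi x ** phi y,
      forall x y, sH x -> sH y -> phi x = phi y -> x = y,
      forall y, exists x, sH (s := L) x /\ phi x = y
    & forall i x, sH x -> iter_dom (@sH _ L) (@sf _ L) i.+1 x <-> iter_dom H f i (phi x)].
Proof.
have [n [b [phi [_ [basis [phiM [phi_inj [phi_surj [phiH phif]]]]]]]]] := lifting.
have ssp := sspP L.
have [_ [_ GH]] := basis.
have HL x : sH x <-> gen_range b 1 n x.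
  by have [//|_ Hr] := GH 0; split=> [Hx | /Hr[]] //; apply/Hr.
have sub x : gen_range b 1 n.-1 x -> sH x.
  by move=> Rx; apply/HL; apply: gen_range_subset Rx => //; lia.
have phi_dom x : sH x -> gen_range b 1 n.-1 x <-> H (phi x).
  move=> Hx; split=> [Rx | /phiH[x' [Rx' E]]]; first by apply/phiH; exists x.
  by rewrite (_ : x = x') //; apply: phi_inj; [apply/HL | apply/HL; apply: sub |].
(* For $n>0$, an image lying in the domain is in $H_1=\langle b_2,\dots,b_n\rangle$, and shifting
   back drops $b_n$. For $n=0$ the domain is trivial. *)
have f_dom x : sH x -> gen_range b 1 n.-1 x <-> sH (sf x).
  move=> Hx; case: (posnP n) => n0; last split=> [Rx | Hfx].
  - have -> : x = gone.
      by apply: (@gen_range_empty _ b 1 n); [rewrite n0 | apply/HL].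
    have [S1 _] := ssp_subgroup ssp.
    rewrite (hom1 (ssp_subgroup ssp) (ssp_hom ssp)); split=> // _.
    by have [] := gen_subgroup (fun x => exists k, 1 <= k <= n.-1 /\ x = b k).
  - have := @range_shift _ _ _ _ _ _ ssp basis 1 n.-1 1 x isT.
    rewrite !addn1 prednK // => /(_ (leqnSn n) Rx) Rfx.
    by apply/HL; apply: gen_range_subset Rfx.
  have [|_ Hr] := GH 1; first by lia.
  have Rfx : gen_range b (1 + 1) (n.-1 + 1) (sf x).
    by rewrite !addn1 prednK //; apply/Hr; split=> //; exists x.
  have [||x' [Rx' E]] := range_unshift ssp basis _ _ Rfx; [by [] | by lia |].
  by rewrite (ssp_inj ssp Hx (sub _ Rx') E).
exists phi; split.
- by move=> x y /HL Rx /HL Ry; apply: phiM.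
- by move=> x y /HL Rx /HL Ry; apply: phi_inj.
- by move=> y; have [x [Rx E]] := phi_surj y; exists x; split=> //; apply/HL.
elim=> [|i IH] x Hx; first by [].
split=> [[_ Dfx] | [Hphi Dphi]].
  have Rx : gen_range b 1 n.-1 x by apply/f_dom => //; case: Dfx.
  split; first by apply/phi_dom.
  by rewrite -phif //; apply/IH => //; case: Dfx.
have Rx : gen_range b 1 n.-1 x by apply/phi_dom.
by split=> //; apply/IH; [apply/f_dom | rewrite phif].
Qed.

Lemma lifting_noncommutative i :
    (exists x y, [/\ iter_dom H f i x, iter_dom H f i y & ~ commute x y]) ->
  exists x y : sg L,
    [/\ iter_dom (@sH _ L) (@sf _ L) i.+1 x, iter_dom (@sH _ L) (@sf _ L) i.+1 y & ~ commute x y].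
Proof.
have [phi [phiM phi_inj phi_surj phiD]] := lifting_iso.
move=> [x' [y' [Dx Dy NC]]].
have [x [Hx Ex]] := phi_surj x'; have [y [Hy Ey]] := phi_surj y'.
exists x, y; split; [by apply/phiD; rewrite ?Ex | by apply/phiD; rewrite ?Ey |].
by move=> C; apply: NC; rewrite -Ex -Ey /commute -!phiM // C.
Qed.

(** Used to bound the length of the top of a tower from above. *)
Lemma lifting_trivial_dom i :
    (forall x, iter_dom H f i x -> x = gone) ->
  forall x, iter_dom (@sH _ L) (@sf _ L) i.+1 x -> x = gone.
Proof.
have [phi [phiM phi_inj phi_surj phiD]] := lifting_iso.
move=> triv x Dx; have Hx : sH x by case: Dx.
have H1 : sH (gone : sg L) by case: (ssp_subgroup (sspP L)).
apply: phi_inj => //; rewrite (triv (phi x)); last by apply/phiD.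
by apply: (@gmulI _ (phi gone)); rewrite -phiM // gmul1 gmulr1.
Qed.

End Lifting.

Theorem theorem4p1 (p : option nat) (G : group) (H : gset G) (f : G -> G)
  (n c : nat) (a : nat -> G) :
  valid_p p ->
  SSP p (@gsetT G) H f ->
  has_length p (@gsetT G) n ->
  canonical_basis (@gsetT G) H f n a ->
  cutoff n a c ->
  metabelian G ->
  3 <= n ->
  exists j, j <= qn n /\ c = cnj n j /\
    (c < n ->
       comm (a 1) (a c.+1) <> gone /\
       gen_range a (qn n + 1 - j) (qn n + 1 + rn n + 2 * j) (comm (a 1) (a c.+1))) /\
    (c < n ->
       exists N : nat, forall (L : nat -> sspg p) (m : nat),
         (0 < m -> is_lifting (L 0) H f) ->
         (forall i, i.+1 < m -> is_lifting (L i.+1) (@sH p (L i)) (@sf p (L i))) ->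
         m <= N).
Proof.
move=> p_valid ssp _ basis [c_bounds [c_le c_neq]] _ n3.
have n_gt0 : 0 < n by lia.
have c_gt0 : 0 < c by lia.
(* With this $j$, $n-c+1=q+1-j$ and $2c-n+1=q+1+r+2j$, so the range is that of [comm_basis_support];
   $2n\le 3c$ makes the subtraction exact. *)
exists (c - 2 * qn n - rn n); rewrite /cnj /qn /rn.
have [c_ltn | c_ge] := ltnP c n; last by do !split => //; lia.
have w_neq1 := c_neq c_ltn.
have [Rw c_ge] :=
  comm_basis_support ssp basis c_le p_valid w_neq1 n_gt0 c_gt0 c_ltn w_neq1.
split; first by lia.
split; first by lia.
split=> _; first by split=> //; apply: gen_range_subset Rw; lia.
exists n => L m L0 LS.
(* [L 0] is the first lifting of [G], so [L i] lies $i+1$ steps above it. The pair $a_1,a_{c+1}$ and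
   the triviality of $D_n$ are carried upwards. *)
have tower i : i < m ->
    (exists x y : sg (L i), [/\ iter_dom (@sH _ (L i)) (@sf _ (L i)) i.+1 x,
       iter_dom (@sH _ (L i)) (@sf _ (L i)) i.+1 y & ~ commute x y]) /\
    (forall x : sg (L i), iter_dom (@sH _ (L i)) (@sf _ (L i)) (n + i).+1 x -> x = gone).
  elim: i => [|i IH] im.
    split; first apply: (lifting_noncommutative (L0 im)).
      by exists (a 1), (a c.+1); split=> // /comm1P.
    apply: (lifting_trivial_dom (L0 im)) => x; rewrite addn0.
    exact: (iter_dom_length ssp basis).
  have [NC triv] := IH (ltnW im); have Li := LS i im.
  split; first exact: (lifting_noncommutative Li).
  by rewrite addnS; apply: (lifting_trivial_dom Li).
case: m L0 LS tower => // m L0 LS /(_ m (leqnn _)) [[x [y [Dx Dy NC]]] triv].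
have [N [b b_basis]] : exists N b, canonical_basis gsetT (@sH p (L m)) (@sf p (L m)) N b.
  case: m L0 LS {x y Dx Dy NC triv} => [L0 _ | m _ LS].
    by have [N [b [_ [_ [B _]]]]] := L0 isT; exists N.+1, b.
  by have [N [b [_ [_ [B _]]]]] := LS m (leqnn _); exists N.+1, b.
have [N_gt0 mN] := noncommutative_length p_valid (sspP (L m)) b_basis Dx Dy NC.
have x_neq1 : x <> gone by move=> x1; apply: NC; rewrite x1 /commute gmul1 gmulr1.
(* Otherwise the nontrivial $b_1$ would lie in the trivial domain $D_{n+m+1}$. Together with
   $3(m+1)\le N$ this yields $2(m+1)\le n$. *)
have N_le : N <= n + m.+1.
  rewrite leqNgt; apply/negP => nN.
  apply: (basis1_neq1 (sspP (L m)) b_basis x_neq1 N_gt0); apply: triv.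
  by have [||] := basis_shift b_basis (i := 1) (k := (n + m).+1); try lia.
by lia.
Qed.
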